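(* There is a function $p^{\leqslant}_\lambda(r,\ell_1,\ell_2,m)$, given by a closed-form formula in the parameters and defined for all real $0<\lambda\leqslant 1/6$ and all integers $r\geqslant 2$, $m\geqslant 1$, $0\leqslant \ell_1\leqslant \ell_2$, $\ell_2\geqslant 1$, such that the following hold. (i) If a presentation is chosen uniformly at random from the set of all presentations of the form $\langle X\mid W\rangle$ where $|X|=r$, $|W|=m$ and $\ell_1\leqslant |w|\leqslant \ell_2$ for each $w\in W$, then it is power-free and satisfies the metric small cancellation condition $C'(\lambda)$ with probability at least $p^{\leqslant}_\lambda(r,\ell_1,\ell_2,m)$. (ii) We have $$1-p^{\leqslant}_\lambda(r,\ell_1,\ell_2,m)\leqslant 8m^2 r\,\ell_2^2(\ell_2-\ell_1+1)(2r-1)^{-\lambda\ell_2-1},$$ and thus $\lim_{\ell_2\to\infty}p^{\leqslant}_\lambda(r,\ell_1,\ell_2,m)=1$ for each fixed $r\geqslant 2$, $\lambda$ and $m$.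
   Context: Let $X$ be a fixed set with $r$ elements and $F(X)$ the free group on $X$, whose elements are identified with freely reduced words over $X^{\pm1}$; $|w|$ denotes word length. A word is cyclically reduced if all its cyclic permutations are freely reduced. For $0\leqslant d<|w|$, $w_{\ll d}$ denotes the left cyclic permutation of $w$ by distance $d$ (the first $d$ letters are moved to the end). A presentation $\langle X\mid W\rangle$ with $r$ generators and $m=|W|$ relators is given by an ordered list $W\in F(X)^m$ of cyclically reduced words; repetitions are allowed, and lists differing by a permutation are considered distinct. ''Chosen uniformly at random'' refers to the uniform distribution on such lists for fixed $X$. The symmetric closure of a list $W$ is $W^S=\{w_{\ll d},(w_{\ll d})^{-1} : w\in W,\ 0\leqslant d<|w|\}$. The list $W$ is minimal if there is no proper sublist $U$ with $U^S=W^S$. A cyclically reduced word $w$ is power-free if $|(w)^S|=2|w|$ (equivalently, it is not a proper power); a presentation is power-free if all its relators are. The presentation $\langle X\mid W\rangle$ has metric small cancellation $C'(\lambda)$ if $W$ is minimal, each $w\in W$ is power-free, and for any two distinct words $u,w\in W^S$: if $u=pa$ and $w=pb$ with $p,a,b\in F(X)$, $|u|=|p|+|a|$ and $|w|=|p|+|b|$, then $|p|<\lambda\cdot\min(|u|,|w|)$. A closed-form formula means an explicit expression in $\lambda,r,\ell_1,\ell_2,m$ built from arithmetic operations, powers, rounding, minima, binomial coefficients and finite sums and products. *)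

(* Defs.v *)
From HB Require Import structures.
From mathcomp Require Import all_boot all_order all_algebra.
From mathcomp Require Import all_classical all_reals all_analysis.

Set Implicit Arguments.
Unset Strict Implicit.
Unset Printing Implicit Defensive.

Import Order.TTheory GRing.Theory Num.Theory numFieldNormedType.Exports.

Local Open Scope ring_scope.

(* (x, true) is the generator x and (x, false) its formal inverse. Elements of
   F(X) are the sequences of letters satisfying [reduced]. *)
Definition letter (X : finType) : finType := (X * bool)%type.
Definition word (X : finType) := seq (letter X).

Section Words.
Variable X : finType.
Implicit Types (a : letter X) (u v w : word X).

Definition linv a : letter X := (a.1, ~~ a.2).

Definition reduced w : bool := sorted (fun a b => b != linv a) w.

Definition cons_red a w : word X :=
  if w is b :: w' then if b == linv a then w' else a :: w else [:: a].

Definition free_reduce w : word X := foldr cons_red [::] w.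

Definition fmul u v : word X := free_reduce (u ++ v).

Definition finv w : word X := rev (map linv w).

(* The left cyclic permutation of w by distance d is [rot d w]. *)
Definition cyc_perms w : seq (word X) := [seq rot d w | d <- iota 0 (size w)].

Definition cyc_reduced w : bool := reduced w && all reduced (cyc_perms w).

(* W^S, as a sequence possibly with repetitions: it is to be compared with =i,
   and its cardinality is [size (undup _)]. *)
Definition symcl (W : seq (word X)) : seq (word X) :=
  flatten [seq cyc_perms w ++ map finv (cyc_perms w) | w <- W].

Definition minimal (W : seq (word X)) : Prop :=
  forall U : seq (word X), subseq U W -> U <> W -> ~ (symcl U =i symcl W).

Definition power_free w : bool := size (undup (symcl [:: w])) == (2 * size w)%N.

Definition small_cancellation (R : realType) (lambda : R) (W : seq (word X)) :
    Prop :=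
  [/\ minimal W,
      forall w, w \in W -> power_free w &
      forall u w, u \in symcl W -> w \in symcl W -> u <> w ->
        forall p a b : word X, reduced p -> reduced a -> reduced b ->
          u = fmul p a -> w = fmul p b ->
          size u = (size p + size a)%N -> size w = (size p + size b)%N ->
          (size p)%:R < lambda * (minn (size u) (size w))%:R].

(* Ordered lists of m cyclically reduced words with lengths in [l1, l2]; the
   upper bound is carried by the type of bounded sequences. *)
Definition presentations (l1 l2 m : nat) :
    {set m.-tuple (l2.-bseq (letter X))} :=
  [set W : m.-tuple (l2.-bseq (letter X)) |
    all (fun w : l2.-bseq (letter X) => cyc_reduced w && (l1 <= size w)%N) W].

Definition relators (l2 m : nat) (W : m.-tuple (l2.-bseq (letter X))) :
    seq (word X) := map (@bseqval l2 (letter X)) W.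

End Words.

(* Probability of the event E under the uniform distribution on A. *)
Definition unif_prob (R : realType) (T : finType) (A : {set T}) (E : T -> Prop) :
    R := #|[set x in A | `[< E x >] ]|%:R / #|A|%:R.

(* Closed-form expressions in lambda, r, l1, l2, m. In [CFsum a b e] and
   [CFprod a b e] the index runs over the integers from a to b inclusive and is
   bound in e as the de Bruijn variable [CFidx 0]. *)
Inductive cf : Type :=
  | CFlambda | CFr | CFl1 | CFl2 | CFm
  | CFidx of nat
  | CFnat of nat
  | CFadd of cf & cf
  | CFsub of cf & cf
  | CFmul of cf & cf
  | CFdiv of cf & cf
  | CFpow of cf & cf
  | CFfloor of cf
  | CFceil of cf
  | CFmin of cf & cf
  | CFbin of cf & cf
  | CFsum of cf & cf & cf
  | CFprod of cf & cf & cf.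

Definition zrange (i j : int) : seq int :=
  [seq i + k%:Z | k <- iota 0 (absz (Num.max 0 (j - i + 1)))].

(* [cf_value lambda r l1 l2 m rho e x]: e is defined and has value x, where rho
   lists the values of the bound indices, innermost first. It is a relation so
   that undefined expressions (division by 0, noninteger powers of negative
   numbers, ...) have no value instead of a conventional one. *)
Inductive cf_value (R : realType) (lambda : R) (r l1 l2 m : nat) :
    seq int -> cf -> R -> Prop :=
  | VLambda rho : cf_value lambda r l1 l2 m rho CFlambda lambda
  | VR rho : cf_value lambda r l1 l2 m rho CFr r%:R
  | VL1 rho : cf_value lambda r l1 l2 m rho CFl1 l1%:R
  | VL2 rho : cf_value lambda r l1 l2 m rho CFl2 l2%:R
  | VM rho : cf_value lambda r l1 l2 m rho CFm m%:R
  | VIdx rho k : (k < size rho)%N ->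
      cf_value lambda r l1 l2 m rho (CFidx k) (nth 0 rho k)%:~R
  | VNat rho n : cf_value lambda r l1 l2 m rho (CFnat n) n%:R
  | VAdd rho a b x y :
      cf_value lambda r l1 l2 m rho a x -> cf_value lambda r l1 l2 m rho b y ->
      cf_value lambda r l1 l2 m rho (CFadd a b) (x + y)
  | VSub rho a b x y :
      cf_value lambda r l1 l2 m rho a x -> cf_value lambda r l1 l2 m rho b y ->
      cf_value lambda r l1 l2 m rho (CFsub a b) (x - y)
  | VMul rho a b x y :
      cf_value lambda r l1 l2 m rho a x -> cf_value lambda r l1 l2 m rho b y ->
      cf_value lambda r l1 l2 m rho (CFmul a b) (x * y)
  | VDiv rho a b x y :
      cf_value lambda r l1 l2 m rho a x -> cf_value lambda r l1 l2 m rho b y ->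
      y != 0 -> cf_value lambda r l1 l2 m rho (CFdiv a b) (x / y)
  | VPowInt rho a b x (n : int) :
      cf_value lambda r l1 l2 m rho a x ->
      cf_value lambda r l1 l2 m rho b n%:~R ->
      (x != 0) || (0 <= n) -> cf_value lambda r l1 l2 m rho (CFpow a b) (x ^ n)
  | VPowReal rho a b x y :
      cf_value lambda r l1 l2 m rho a x -> cf_value lambda r l1 l2 m rho b y ->
      0 < x -> cf_value lambda r l1 l2 m rho (CFpow a b) (x `^ y)
  | VFloor rho a x :
      cf_value lambda r l1 l2 m rho a x ->
      cf_value lambda r l1 l2 m rho (CFfloor a) (Num.floor x)%:~R
  | VCeil rho a x :
      cf_value lambda r l1 l2 m rho a x ->
      cf_value lambda r l1 l2 m rho (CFceil a) (Num.ceil x)%:~R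
  | VMin rho a b x y :
      cf_value lambda r l1 l2 m rho a x -> cf_value lambda r l1 l2 m rho b y ->
      cf_value lambda r l1 l2 m rho (CFmin a b) (Num.min x y)
  | VBin rho a b (n k : nat) :
      cf_value lambda r l1 l2 m rho a n%:R ->
      cf_value lambda r l1 l2 m rho b k%:R ->
      cf_value lambda r l1 l2 m rho (CFbin a b) 'C(n, k)%:R
  | VSum rho a b e (i j : int) (f : int -> R) :
      cf_value lambda r l1 l2 m rho a i%:~R ->
      cf_value lambda r l1 l2 m rho b j%:~R ->
      (forall k : int, k \in zrange i j ->
         cf_value lambda r l1 l2 m (k :: rho) e (f k)) ->
      cf_value lambda r l1 l2 m rho (CFsum a b e) (\sum_(k <- zrange i j) f k)
  | VProd rho a b e (i j : int) (f : int -> R) :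
      cf_value lambda r l1 l2 m rho a i%:~R ->
      cf_value lambda r l1 l2 m rho b j%:~R ->
      (forall k : int, k \in zrange i j ->
         cf_value lambda r l1 l2 m (k :: rho) e (f k)) ->
      cf_value lambda r l1 l2 m rho (CFprod a b e) (\prod_(k <- zrange i j) f k).

Lemma cf_value_unique (R : realType) (lambda : R) (r l1 l2 m : nat)
    (rho : seq int) (e : cf) (x y : R) :
  cf_value lambda r l1 l2 m rho e x -> cf_value lambda r l1 l2 m rho e y ->
  x = y.
Proof.
move=> hx; elim: hx y => {rho e x}.
- by move=> rho y h; inversion h.
- by move=> rho y h; inversion h.
- by move=> rho y h; inversion h.
- by move=> rho y h; inversion h.
- by move=> rho y h; inversion h.
- by move=> rho k _ y h; inversion h.
- by move=> rho n y h; inversion h.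
- by move=> rho a b x y _ ha _ hb z h; inversion h; subst; congr (_ + _); auto.
- by move=> rho a b x y _ ha _ hb z h; inversion h; subst; congr (_ - _); auto.
- by move=> rho a b x y _ ha _ hb z h; inversion h; subst; congr (_ * _); auto.
- move=> rho a b x y _ ha _ hb _ z h; inversion h; subst.
  by rewrite (ha _ ltac:(eassumption)) (hb _ ltac:(eassumption)).
- move=> rho a b x n _ ha _ hb _ z h; inversion h; subst.
  + by rewrite (ha _ ltac:(eassumption)) (intr_inj (hb _ ltac:(eassumption))).
  + by rewrite (ha _ ltac:(eassumption)) -(hb _ ltac:(eassumption)) powR_intmul // ltW.
- move=> rho a b x y _ ha _ hb x0 z h; inversion h; subst.
  + by rewrite -(ha _ ltac:(eassumption)) (hb _ ltac:(eassumption)) powR_intmul // ltW.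
  + by rewrite (ha _ ltac:(eassumption)) (hb _ ltac:(eassumption)).
- by move=> rho a x _ ha z h; inversion h; subst; rewrite (ha _ ltac:(eassumption)).
- by move=> rho a x _ ha z h; inversion h; subst; rewrite (ha _ ltac:(eassumption)).
- by move=> rho a b x y _ ha _ hb z h; inversion h; subst; congr Num.min; auto.
- move=> rho a b n k _ ha _ hb z h; inversion h; subst.
  by move: (ha _ ltac:(eassumption)) (hb _ ltac:(eassumption)) => /eqP + /eqP; rewrite !eqr_nat => /eqP-> /eqP->.
- move=> rho a b e i j f _ ha _ hb _ hf z h; inversion h; subst.
  move: (intr_inj (ha _ ltac:(eassumption))) (intr_inj (hb _ ltac:(eassumption))) => ? ?; subst.
  by apply: eq_big_seq => k hk; apply: hf hk _ ltac:(auto).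
- move=> rho a b e i j f _ ha _ hb _ hf z h; inversion h; subst.
  move: (intr_inj (ha _ ltac:(eassumption))) (intr_inj (hb _ ltac:(eassumption))) => ? ?; subst.
  by apply: eq_big_seq => k hk; apply: hf hk _ ltac:(auto).
Qed.

Definition admissible (R : realType) (lambda : R) (r l1 l2 m : nat) : Prop :=
  [/\ 0 < lambda, lambda <= 6%:R^-1, (2 <= r)%N, (1 <= m)%N &
      (l1 <= l2)%N /\ (1 <= l2)%N].

Definition closed_form (R : realType) (p : R -> nat -> nat -> nat -> nat -> R) :
    Prop :=
  exists e : cf, forall (lambda : R) (r l1 l2 m : nat),
    admissible lambda r l1 l2 m ->
    cf_value lambda r l1 l2 m [::] e (p lambda r l1 l2 m).

(* Main.v *)
Require Import Defs.
From mathcomp Require Import all_boot all_order all_algebra.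
From mathcomp Require Import all_classical all_reals all_analysis.
From mathcomp Require Import zify ring lra.

Set Implicit Arguments.
Unset Strict Implicit.
Unset Printing Implicit Defensive.

Import Order.TTheory GRing.Theory Num.Theory numFieldNormedType.Exports.

(* With q = 2r - 1 and k(l) = ceil(lambda l), a list W fails only if some
   relator is empty, two of the 2|w| elements of the symmetric closure of a
   single relator w agree on their first k(|w|) letters, or elements of the
   symmetric closures of two relators w_i and w_j with |w_j| <= |w_i| agree on
   their first k(|w_j|) letters. Writing the word letter by letter, a prescribed
   agreement determines k of the letters, each of which would otherwise have
   about q choices; so it holds for about q^(l - k(l)) of the words of length l,
   which is at most q^((1 - lambda) l2), against at least (1 - q^-2) q^l2 words
   of length l2. Summing over positions, signs, lengths and indices, the failure
   probability is already bounded by the right-hand side of (ii), so one may take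
   for p one minus that expression. *)

(** * Counting words built letter by letter *)

Section LetterByLetter.
Variables (T : finType) (P : seq T -> T -> bool).

(** [P s x] means that the letter [x] may come after the prefix [s]. Since [P] sees the whole
    prefix, it can force a letter to be a function of all earlier ones. *)
Fixpoint extensions n : seq (seq T) :=
  if n is n'.+1
  then [seq rcons s x | s <- extensions n', x <- enum [pred x | P s x]]
  else [:: [::]].

Lemma extensionsP n s :
  reflect (exists t x, [/\ s = rcons t x, t \in extensions n & P t x])
          (s \in extensions n.+1).
Proof.
apply: (iffP allpairsPdep) => [[t [x [tn]]]|[t [x [-> tn Ptx]]]].
  by rewrite mem_enum => Ptx ->; exists t, x.
by exists t, x; rewrite mem_enum.
Qed.

Lemma size_mem_extensions n s : s \in extensions n -> size s = n.
Proof.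
elim: n s => [|n IHn] s; first by rewrite inE => /eqP->.
by case/extensionsP=> t [x [-> /IHn <- _]]; rewrite size_rcons.
Qed.

Lemma extensions_complete s :
  (forall t x u, s = rcons t x ++ u -> P t x) -> s \in extensions (size s).
Proof.
elim/last_ind: s => [|s x IHs] sP; first by rewrite inE.
rewrite size_rcons; apply/extensionsP; exists s, x; split=> //; last first.
  by apply: (sP _ _ [::]); rewrite cats0.
by apply: IHs => t y u e; apply: (sP _ _ (rcons u x)); rewrite e rcons_cat.
Qed.

Lemma extensions_uniq n : uniq (extensions n).
Proof.
elim: n => //= n IHn; apply: allpairs_uniq_dep => // [s _|]; first exact: enum_uniq.
by move=> [s x] [t y] _ _ /= /rcons_inj [-> ->].
Qed.

Lemma size_extensionsS n :
  size (extensions n.+1) = \sum_(s <- extensions n) #|[pred x | P s x]|.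
Proof.
rewrite /= size_allpairs_dep sumnE big_map.
by apply: eq_bigr => s _; rewrite cardE.
Qed.

Lemma size_extensions_le (b : nat -> nat) n :
  (forall s, #|[pred x | P s x]| <= b (size s)) ->
  size (extensions n) <= \prod_(i < n) b i.
Proof.
move=> Pb; elim: n => [|n IHn]; first by rewrite big_ord0.
rewrite size_extensionsS big_ord_recr /=.
apply: (@leq_trans (\sum_(s <- extensions n) b n)).
  rewrite big_seq [leqRHS]big_seq; apply: leq_sum => s sn.
  by rewrite -(size_mem_extensions sn).
by rewrite big_const_seq count_predT iter_addn_0 [b n * _]mulnC leq_mul2r IHn orbT.
Qed.

Lemma size_extensions_ge (b : nat -> nat) n :
  (forall s, b (size s) <= #|[pred x | P s x]|) ->
  \prod_(i < n) b i <= size (extensions n).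
Proof.
move=> Pb; elim: n => [|n IHn]; first by rewrite big_ord0.
rewrite size_extensionsS big_ord_recr /=.
apply: (@leq_trans (\sum_(s <- extensions n) b n)).
  by rewrite big_const_seq count_predT iter_addn_0 [b n * _]mulnC leq_mul2r IHn orbT.
rewrite big_seq [leqRHS]big_seq; apply: leq_sum => s sn.
by rewrite -(size_mem_extensions sn).
Qed.

End LetterByLetter.

(** * Cardinality bounds by injection and by covering *)

Lemma card_le_size (T : finType) (U : eqType) (A : {set T}) (f : T -> U)
    (s : seq U) :
  injective f -> (forall x, x \in A -> f x \in s) -> #|A| <= size s.
Proof.
move=> finj fA; rewrite cardE -(size_map f); apply: uniq_leq_size.
  by rewrite map_inj_uniq ?enum_uniq.
by move=> _ /mapP[x + ->]; rewrite mem_enum; apply: fA.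
Qed.

(** Union bound; the factor [c] carries a denominator, so that the counts stay in the natural
    numbers. *)
Lemma card_cover_le (T I : finType) (A : {set T}) (F : I -> {set T}) (c b : nat) :
  (forall x, x \in A -> exists i, x \in F i) ->
  (forall i, c * #|F i| <= b) -> c * #|A| <= #|I| * b.
Proof.
move=> AF Fb; apply: (@leq_trans (c * \sum_i #|F i|)).
  rewrite leq_mul2l; apply/orP; right.
  under eq_bigr do rewrite -sum1_card.
  rewrite -sum1_card (exchange_big_dep predT) //= big_mkcond /=.
  apply: leq_sum => x _; case: ifP => // /AF [i xi].
  by rewrite (bigD1 i).
by rewrite big_distrr /= -sum_nat_const; apply: leq_sum.
Qed.

(* [finv] alone would be the inverse of an injection from [fingraph]. *)
Local Notation finv := Defs.finv.

(** * Inverses, cyclic reduction and the symmetric closure of one word *)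

Section Letters.
Variable X : finType.
Implicit Types (a b : letter X) (u v w : word X).

Definition follows a b := b != linv a.

Lemma linvK : involutive (@linv X).
Proof. by case=> x s; rewrite /linv /= negbK. Qed.

Lemma linv_neq a : linv a != a.
Proof. by case: a => x [] //=; rewrite /linv xpair_eqE andbF. Qed.

Lemma follows_linv a b : follows (linv a) (linv b) = follows a b.
Proof. by rewrite /follows (inj_eq (inv_inj linvK)). Qed.

Lemma followsC a b : follows a b = follows b a.
Proof. by rewrite /follows eq_sym -(inj_eq (inv_inj linvK)) linvK. Qed.

Lemma finvK : involutive (@finv X).
Proof. by move=> w; rewrite /finv map_rev revK mapK //; apply: linvK. Qed.

Lemma size_finv w : size (finv w) = size w.
Proof. by rewrite /finv size_rev size_map. Qed.

Lemma take_finv n w : n <= size w -> take n (finv w) = finv (drop (size w - n) w).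
Proof. by move=> nw; rewrite /finv take_rev size_map map_drop. Qed.

Lemma cycle_reduced w : cycle follows w -> reduced w.
Proof. by case: w => //= a w; rewrite rcons_path => /andP[]. Qed.

(** The rotation by one already tests the pair formed by the last and first letters, and being a
    cycle is invariant under rotation. *)
Lemma cyc_reducedE w : cyc_reduced w = cycle follows w.
Proof.
rewrite /cyc_reduced; apply/idP/idP => [/andP[wr /allP wc]|wc].
  (* For a single letter the closing condition says that it differs from its own inverse. *)
  case: w wr wc => // a [|b w] wr wc; first by rewrite /= /follows eq_sym linv_neq.
  have: reduced (rot 1 (a :: b :: w)).
    by apply: wc; apply/mapP; exists 1; rewrite ?mem_iota.
  rewrite rot1_cons /= rcons_path => /andP[_ e].
  by move: wr => /= /andP[wb wp]; apply/and3P; split.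
rewrite cycle_reduced //=; apply/allP=> _ /mapP[d _ ->].
by apply: cycle_reduced; rewrite rot_cycle.
Qed.

Lemma cyc_reduced_rot d w : cyc_reduced (rot d w) = cyc_reduced w.
Proof. by rewrite !cyc_reducedE rot_cycle. Qed.

Lemma cyc_reduced_finv w : cyc_reduced (finv w) = cyc_reduced w.
Proof.
rewrite !cyc_reducedE /finv rev_cycle.
rewrite (eq_cycle (e' := follows)) => [|a b /=]; last by rewrite followsC.
by rewrite cycle_map; apply: eq_cycle => a b /=; rewrite follows_linv.
Qed.

Lemma size_free_reduce w : size (free_reduce w) <= size w.
Proof.
elim: w => [|a w] /=; first by [].
rewrite /cons_red; case: (free_reduce w) => [|b v] /=; first by [].
by case: ifP => _ /= h; lia.
Qed.

(* A product in which no length is lost involves no cancellation. *)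
Lemma free_reduce_id w : size (free_reduce w) = size w -> free_reduce w = w.
Proof.
elim: w => [|a w] //=; move: (size_free_reduce w); rewrite /cons_red.
case: (free_reduce w) => [|b v] /=; first by move=> _ IHw [e]; rewrite -IHw.
by case: ifP => _ /= lw IHw e; [exfalso; lia | rewrite IHw //; lia].
Qed.

Lemma fmul_cat u v : size (fmul u v) = size u + size v -> fmul u v = u ++ v.
Proof. by rewrite -size_cat; apply: free_reduce_id. Qed.

(** Repetitions are kept: the 2|w| entries are pairwise distinct exactly when [w] is power-free. *)
Definition sym_seq w := cyc_perms w ++ map (@finv X) (cyc_perms w).

Lemma symclP (W : seq (word X)) u :
  reflect (exists2 w, w \in W & u \in sym_seq w) (u \in symcl W).
Proof. exact: flatten_mapP. Qed.

Lemma sym_seqP w u :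
  reflect (exists d s, d < size w /\ u = (if s then id else @finv X) (rot d w))
    (u \in sym_seq w).
Proof.
rewrite mem_cat; apply: (iffP orP) => [[]|[d [[] [dw ->]]]].
- case/mapP=> d; rewrite mem_iota => /andP[_ dw] ->.
  by exists d, true.
- case/mapP=> _ /mapP[d + ->] ->; rewrite mem_iota => /andP[_ dw].
  by exists d, false.
- by left; apply/mapP; exists d; rewrite ?mem_iota.
- by right; apply/map_f/mapP; exists d; rewrite ?mem_iota.
Qed.

Lemma size_cyc_perms w : size (cyc_perms w) = size w.
Proof. by rewrite size_map size_iota. Qed.

Lemma size_sym_seq w : size (sym_seq w) = 2 * size w.
Proof. by rewrite size_cat size_map size_cyc_perms; lia. Qed.

Lemma sym_seq_size w u : u \in sym_seq w -> size u = size w.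
Proof. by case/sym_seqP=> d [[] [_ ->]]; rewrite ?size_finv size_rot. Qed.

Lemma sym_seq_self w : w != [::] -> w \in sym_seq w.
Proof.
case: w => // a w _; apply/sym_seqP; exists 0, true; by rewrite rot0.
Qed.

End Letters.

(** * A combinatorial criterion for small cancellation *)

Lemma mem_mask_nth (T : eqType) (x0 x : T) m s : x \in mask m s ->
  exists j, [/\ j < size s, nth false m j & nth x0 s j = x].
Proof.
elim: s m => [|y s IHs] [|b m] //=.
have IH : x \in mask m s ->
    exists j, [/\ j < (size s).+1, nth false (b :: m) j & nth x0 (y :: s) j = x].
  by move=> /IHs[j [js mj sj]]; exists j.+1.
by case: b IH => //= IH; rewrite inE => /predU1P[->|/IH //]; exists 0.
Qed.

Section Criterion.
Variables (X : finType) (k : nat -> nat).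
Implicit Types (u v w : word X) (W : seq (word X)).

(** Distinctness is asked of prefixes rather than of whole words, so that it yields power-freeness
    and also bounds the pieces between elements coming from the same relator. *)
Definition self_good w :=
  (w != [::]) && uniq (map (take (k (size w))) (sym_seq w)).

(** The second word is the shorter one and sets the prefix length, in accordance with the minimum in
    the small cancellation condition. *)
Definition clash w w' :=
  (size w' <= size w) &&
  has [in map (take (k (size w'))) (sym_seq w)]
    (map (take (k (size w'))) (sym_seq w')).

Definition all_good W :=
  all self_good W /\
  forall i j, i < size W -> j < size W -> i != j ->
    ~~ clash (nth [::] W i) (nth [::] W j).

Lemma clashP w w' u v :
  size w' <= size w -> u \in sym_seq w -> v \in sym_seq w' ->
  take (k (size w')) u = take (k (size w')) v -> clash w w'.
Proof.
move=> le_w uw vw' e; rewrite /clash le_w /=; apply/hasP.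
by exists (take (k (size w')) v); rewrite ?inE; [apply: map_f | rewrite -e map_f].
Qed.

Lemma self_good_power_free w : self_good w -> power_free w.
Proof.
case/andP=> _ /map_uniq uw; rewrite /power_free /symcl /= cats0.
by rewrite undup_id ?size_sym_seq.
Qed.

(** A common element agrees with itself on every prefix, so for distinct indices it would produce a
    clash. *)
Lemma all_good_disjoint W i j u :
  all_good W -> i < size W -> j < size W ->
  u \in sym_seq (nth [::] W i) -> u \in sym_seq (nth [::] W j) -> i = j.
Proof.
move=> [_ Wg] iW jW ui uj; apply/eqP/negP => /negP ij.
case/orP: (leq_total (size (nth [::] W j)) (size (nth [::] W i))) => le_ij.
  by have /negP[] := Wg _ _ iW jW ij; apply: (clashP le_ij ui uj).
by rewrite eq_sym in ij; have /negP[] := Wg _ _ jW iW ij; apply: (clashP le_ij uj ui).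
Qed.

(** If position [i] were dropped, its relator would have to lie in the closure of some retained
    relator, whose index must then be [i]. *)
Lemma all_good_minimal W : all_good W -> minimal W.
Proof.
move=> Wg U /subseqP[msk szm ->] neU eqU; apply: neU.
suff /all_pred1P -> : all (pred1 true) msk by rewrite szm mask_true.
apply/(all_nthP false) => i im; apply/eqP/negP => /negP /negbTE mi.
have iW : i < size W by rewrite -szm.
have [/allP Wself _] := Wg.
have w0 : nth [::] W i != [::] by have /andP[] := Wself _ (mem_nth [::] iW).
have: nth [::] W i \in symcl W.
  by apply/symclP; exists (nth [::] W i); rewrite ?mem_nth ?sym_seq_self.
rewrite -eqU => /symclP[_ /(nthP [::])[j' ltj <-]] wj.
have [j [jW mj wjE]] := mem_mask_nth [::] (mem_nth [::] ltj).
rewrite -wjE in wj.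
by move: mi; rewrite (all_good_disjoint Wg iW jW (sym_seq_self w0) wj) mj.
Qed.

(** A common prefix [p] with |p| at least lambda times the smaller length has at least [k] letters,
    so the two elements agree on their first [k] letters. *)
Lemma all_good_small_cancellation (R : realType) (lambda : R) W :
  (forall l n : nat, (0 < l)%N -> lambda * l%:R <= n%:R -> (k l <= n)%N)%R ->
  all_good W -> small_cancellation lambda W.
Proof.
move=> kP Wg; have [/allP Wself Wpair] := Wg; split.
- exact: all_good_minimal.
- by move=> w /Wself /self_good_power_free.
move=> u v /symclP[_ /(nthP [::])[i iW <-] ui] /symclP[_ /(nthP [::])[j jW <-] vj].
move=> uv p a b _ _ _ ue ve su sv.
have {}ue : u = p ++ a by rewrite ue fmul_cat // -ue su.
have {}ve : v = p ++ b by rewrite ve fmul_cat // -ve sv.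
have agree n : n <= size p -> take n u = take n v.
  by move=> np; rewrite ue ve !takel_cat.
have pos t : t < size W -> 0 < size (nth [::] W t).
  by move=> tW; rewrite lt0n size_eq0; have /andP[] := Wself _ (mem_nth [::] tW).
rewrite (sym_seq_size ui) (sym_seq_size vj) ltNge; apply/negP => le_p.
(* Within one relator, equal prefixes sit at equal positions of [sym_seq], so the two elements
   coincide; for two relators they give a clash. *)
have [eij|ij] := eqVneq i j.
  case: uv; rewrite -eij minnn in vj le_p.
  have /andP[_ uniqW] := Wself _ (mem_nth [::] iW).
  have /(nthP [::])[x xs xu] := ui; have /(nthP [::])[y ys yv] := vj.
  rewrite -xu -yv; congr nth; apply/eqP.
  rewrite -(nth_uniq [::] _ _ uniqW) ?size_map //.
  by rewrite !(nth_map [::]) // xu yv agree // kP // pos.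
case/orP: (leq_total (size (nth [::] W j)) (size (nth [::] W i))) => le_ij.
  have /negP[] := Wpair _ _ iW jW ij; apply: (clashP le_ij ui vj).
  by apply: agree; rewrite (minn_idPr le_ij) in le_p; apply: kP; rewrite ?pos.
have /negP[] := Wpair _ _ jW iW (contra_neq esym ij).
apply: (clashP le_ij vj ui); apply/esym/agree.
by rewrite (minn_idPl le_ij) in le_p; apply: kP; rewrite ?pos.
Qed.
End Criterion.

(** * Coincidences of prefixes within one cyclic word *)

Lemma take_rot (T : Type) n e (s : seq T) :
  e + n <= size s -> take n (rot e s) = take n (drop e s).
Proof. by move=> le_s; rewrite /rot takel_cat // size_drop; lia. Qed.

Lemma rot_rot_ex (T : Type) a b (s : seq T) : a <= size s -> b < size s ->
  exists2 c, c < size s & rot a (rot b s) = rot c s.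
Proof.
move=> al bl; rewrite rot_add_mod ?(ltnW bl) //; case: ifP => abs; last first.
  by exists (a + b - size s); first lia.
case: (ltnP (a + b) (size s)) => ab; first by exists (a + b).
by exists 0; [lia | rewrite rot0 rot_oversize].
Qed.

Lemma rot_ex (T : Type) a b (s : seq T) : a < size s -> b < size s ->
  exists2 c, c < size s & rot a s = rot c (rot b s).
Proof.
move=> al bl; case: (leqP b a) => ab.
  by exists (a - b); [lia | rewrite -rotD subnK // ltnW].
exists (a + size s - b); first lia.
rewrite rot_add_mod; [|lia|lia]; case: ifP => h; last by congr rot; lia.
by have -> : a = 0 by [lia]; rewrite rot0 rot_oversize //; lia.
Qed.

Section SelfOverlap.
Variable X : finType.
Implicit Types (u v w x : word X).

(* Were it to hold, the middle of the union of the two occurrences would be a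
   letter equal to its inverse or two adjacent letters inverse to each other. *)
Lemma reduced_inv_overlap x e n : reduced x -> e < n -> e + n <= size x ->
  take n (drop e x) <> finv (take n x).
Proof.
move=> xr en le_x eqx.
have [a0 _] : exists a0 : letter X, true by case: x le_x {xr eqx} => [|a ? _] /=; [lia | exists a].
have xE j : j < n -> nth a0 x (e + j) = linv (nth a0 x (n.-1 - j)).
  move=> jn; have := congr1 (fun s => nth a0 s j) eqx.
  have szt : size (take n x) = n by rewrite size_takel; lia.
  rewrite nth_take // nth_drop => ->; rewrite nth_rev size_map szt //.
  by rewrite (nth_map a0) ?szt ?nth_take; [congr (linv (nth _ _ _))|..]; lia.
(* The positions paired by [xE] have sum e + n - 1. If it is odd, the two middle letters are
   adjacent and mutually inverse; if it is even, one letter is its own inverse. *)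
case: (boolP (odd (n.-1 - e))) => par.
  have := xE ((n.-1 - e)./2.+1) ltac:(lia).
  have -> : e + (n.-1 - e)./2.+1 = (n.-1 - (n.-1 - e)./2.+1).+1 by lia.
  move/sortedP: xr => /(_ a0 (n.-1 - (n.-1 - e)./2.+1) ltac:(lia)) /eqP xr eqi.
  exact: xr.
have := xE ((n.-1 - e)./2) ltac:(lia).
have -> : e + (n.-1 - e)./2 = n.-1 - (n.-1 - e)./2 by lia.
by move=> /esym /eqP; rewrite (negPf (linv_neq _)).
Qed.

(** A prefix and an occurrence of its inverse cannot overlap on either side of the cyclic word. *)
Lemma cyc_reduced_inv_overlap x e n :
  cyc_reduced x -> n <= size x -> (1 < size x -> 2 * n <= size x) ->
  e < size x -> 0 < n -> take n (rot e x) = finv (take n x) ->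
  n <= e /\ e + n <= size x.
Proof.
move=> xc nl nl2 el n0 eqx.
have red (y : word X) : cyc_reduced y -> reduced y by case/andP.
case: (leqP (e + n) (size x)) => le_x.
  split=> //; rewrite leqNgt; apply/negP => en.
  by case: (reduced_inv_overlap (red _ xc) en le_x); rewrite -take_rot.
(* If the second occurrence wraps around, restart the word at [e]: the original prefix then begins
   at distance [size x - e], less than [n], and the roles of the two factors are exchanged. *)
case: (@reduced_inv_overlap (rot e x) (size x - e) n); rewrite ?size_rot.
- by apply: red; rewrite cyc_reduced_rot.
- lia.
- lia.
rewrite -take_rot ?size_rot; last lia.
rewrite -rotD subnK ?(ltnW el) // rot_size.
by rewrite eqx finvK.
Qed.

(** The factor of length [n] at [e] repeats the prefix, possibly overlapping it, or is the inverse
    of the prefix and disjoint from it. In both cases each letter of the factor is determined by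
    earlier letters. *)
Definition overlap (s : bool) n e x :=
  [&& 0 < e, s || (n <= e), e + n <= size x &
    take n (drop e x) == (if s then id else @finv X) (take n x)].

Lemma rot_overlap w n a b :
  n <= size w -> (1 < size w -> 2 * n <= size w) ->
  a < size w -> b < size w -> a != b ->
  take n (rot a w) = take n (rot b w) ->
  exists d e, [/\ d < size w, e < size w & overlap true n e (rot d w)].
Proof.
move=> nl nl2; wlog ab : a b / a < b => [hw al bl ab eqw|].
  case: (ltngtP a b) ab => // ab _.
    by apply: (hw a b) => //; rewrite neq_ltn ab.
  by apply: (hw b a) => //; rewrite neq_ltn ab.
move=> al bl _ eqw.
have rba : rot b w = rot (b - a) (rot a w) by rewrite -rotD subnK //; lia.
case: (leqP (b - a + n) (size w)) => le_w.
  exists a, (b - a); split; [by []|lia|]; apply/and4P; rewrite size_rot.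
  split=> //; first lia.
  by rewrite -take_rot ?size_rot // -rba eqw.
(* The occurrence at [b] wraps around past [a], so [b] serves as the origin; as 2n is at most |w|,
   the occurrence at [a] then does not wrap. *)
exists b, (size w - (b - a)); split; [by []|lia|]; apply/and4P; rewrite size_rot.
split=> //; [lia|lia|].
rewrite -take_rot ?size_rot; last lia.
suff -> : rot (size w - (b - a)) (rot b w) = rot a w by rewrite eqw.
have le_ba : b - a <= size w by lia.
by rewrite rba -rotD ?size_rot subnK // -(size_rot a w) rot_size.
Qed.

Lemma not_uniq_iota (T : eqType) (f : nat -> T) n :
  ~~ uniq [seq f i | i <- iota 0 n] ->
  exists i j, [/\ i < n, j < n, i != j & f i = f j].
Proof.
move/(uniqPn (f 0)) => [i [j [ij jn]]]; rewrite size_map size_iota in jn.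
rewrite !(nth_map 0) ?size_iota ?nth_iota ?add0n //; try lia.
by move=> e; exists i, j; split=> //; lia.
Qed.

(** The prefix of an inverted rotation is the inverse of the prefix of another rotation, so every
    coincidence compares two factors of the cyclic word [w], up to inversion. *)
Lemma not_uniq_overlap w n :
  cyc_reduced w -> 0 < n <= size w -> (1 < size w -> 2 * n <= size w) ->
  ~~ uniq (map (take n) (sym_seq w)) ->
  exists d e s, [/\ d < size w, e < size w & overlap s n e (rot d w)].
Proof.
move=> wc /andP[n0 nl] nl2.
have take_finv_rot d : take n (finv (rot d w)) = finv (take n (rot (size w - n) (rot d w))).
  rewrite take_finv size_rot // take_rot ?size_rot ?subnK //.
  by rewrite take_oversize // size_drop size_rot subKn.
rewrite /sym_seq map_cat cat_uniq !negb_and negbK => /or3P[].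
- rewrite -map_comp => /not_uniq_iota[a [b [al bl ab eqw]]].
  have [d [e [dl el ov]]] := rot_overlap nl nl2 al bl ab eqw.
  by exists d, e, true.
(* A rotation against an inverted rotation: the factors are disjoint by
   [cyc_reduced_inv_overlap]. *)
- case/hasP=> _ /mapP[_ /mapP[_ /mapP[b + ->] ->] ->].
  rewrite mem_iota add0n => /andP[_ bl].
  case/mapP=> _ /mapP[a + ->]; rewrite mem_iota add0n => /andP[_ al].
  rewrite take_finv_rot.
  have [c cl ->] := rot_rot_ex (leq_subr n (size w)) bl.
  have [e el ->] := rot_ex cl al.
  move=> eqw; have xc : cyc_reduced (rot a w) by rewrite cyc_reduced_rot.
  have eqw' : take n (rot e (rot a w)) = finv (take n (rot a w)).
    by rewrite -eqw finvK.
  have := @cyc_reduced_inv_overlap (rot a w) e n xc.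
  rewrite size_rot => /(_ nl nl2 el n0 eqw') [ne le_w].
  exists a, e, false; split=> //; apply/and4P; rewrite size_rot; split=> //.
    lia.
  by rewrite -take_rot ?size_rot // eqw'.
(* Two inverted rotations: cancelling the inversions leaves two plain rotations of the word [y]. *)
rewrite -map_comp -map_comp.
move/not_uniq_iota=> [a [b [al bl ab]]] /=; rewrite !take_finv_rot.
move/(inv_inj (@finvK X)); rewrite ![rot (size w - n) (rot _ _)]rot_rot => eqw.
set y := rot (size w - n) w in eqw; have sy : size y = size w by rewrite size_rot.
have [||||d [e [dl el ov]]] := @rot_overlap y n a b _ _ _ _ ab eqw; rewrite ?sy //.
have [c cl yw] := @rot_rot_ex _ d (size w - n) w ltac:(lia) ltac:(lia).
by exists c, e, true; rewrite -yw -sy; split=> //; rewrite ?sy.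
Qed.

End SelfOverlap.

(** * Numbers of reduced words with prescribed letters *)

Lemma prod_window (q e n l : nat) : e + n <= l ->
  \prod_(i < l) (if e <= i < e + n then 1 else q) = q ^ (l - n).
Proof.
move=> le_l; rewrite -(big_mkord xpredT (fun i => if e <= i < e + n then 1 else q)).
rewrite (big_cat_nat (n := e)) //=; last lia.
rewrite (big_cat_nat (n := e + n) (m := e)) //=; last lia.
rewrite (eq_big_nat _ _ (F2 := fun=> q)) => [|i ie]; last by case: ifP => //; lia.
rewrite [X in _ * (X * _)](eq_big_nat _ _ (F2 := fun=> 1)) => [|i ->] //.
rewrite [X in _ * (_ * X)](eq_big_nat _ _ (F2 := fun=> q)) => [|i ie]; last by case: ifP => //; lia.
by rewrite !prod_nat_const_nat exp1n mul1n -expnD; congr (_ ^ _); lia.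
Qed.

Section Counting.
Variables (X : finType) (a0 : letter X).
Implicit Types (w p : word X) (g : word X -> letter X).
Local Notation q := (2 * #|X|).-1.

Definition fits (s : word X) (x : letter X) :=
  if s is a :: s' then follows (last a s') x else true.

Lemma reduced_fits s x u : reduced (rcons s x ++ u) -> fits s x.
Proof.
case: s => //= a s; rewrite cat_path rcons_path => /andP[/andP[_ e] _].
exact: e.
Qed.

Lemma fits_reduced s x : reduced s -> fits s x -> reduced (rcons s x).
Proof. by case: s => //= a s rs fx; rewrite rcons_path rs. Qed.

Lemma card_letter : #|letter X| = 2 * #|X|.
Proof. by rewrite card_prod card_bool mulnC. Qed.

Lemma generators_gt0 : 0 < #|X|.
Proof. by apply/card_gt0P; exists a0.1. Qed.

Lemma card_fits s : #|fits s| = if size s == 0 then 2 * #|X| else q.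
Proof.
case: s => [|a s] /=; rewrite -card_letter; first by apply: eq_card.
rewrite -(cardC1 (linv (last a s))); apply: eq_card => x.
by rewrite !inE.
Qed.

(** Letters in the window from [e] to e + n - 1 have one choice, the first letter outside it 2r
    choices, all others q. The factor [q] on the left avoids the exponent l - n - 1. *)
Lemma words_determined e n l g : e + n <= l -> 0 < e + n ->
  exists2 s, q * size s <= (if e == 0 then q else 2 * #|X|) * q ^ (l - n) &
    forall w, reduced w -> size w = l ->
      (forall i, e <= i < e + n -> nth a0 w i = g (take i w)) -> w \in s.
Proof.
move=> le_l en0.
pose P (s : word X) x := fits s x && ((e <= size s < e + n) ==> (x == g s)).
exists (extensions P l) => [|w wr wl wg]; last first.
  rewrite -wl; apply: extensions_complete => t x u we.
  rewrite /P (@reduced_fits t x u) -?we //=; apply/implyP => /wg.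
  by rewrite we -cats1 -catA take_size_cat // nth_cat ltnn subnn /= => ->.
pose b i := if e <= i < e + n then 1 else if i == 0 then 2 * #|X| else q.
apply: (@leq_trans (q * \prod_(i < l) b i)).
  rewrite leq_mul2l; apply/orP; right; apply: size_extensions_le => s.
  rewrite /b; case: ifP => sen; last first.
    rewrite -card_fits; apply: subset_leq_card; apply/fintype.subsetP => x.
    by rewrite !inE => /andP[].
  rewrite -(card1 (g s)); apply: subset_leq_card; apply/fintype.subsetP => x.
  by rewrite !inE /P sen => /andP[].
(* With [e] zero the first letter lies in the window, so the factor 2r does not occur. *)
case: ifP => e0.
  rewrite -(prod_window q le_l) leq_mul2l; apply/orP; right.
  apply: leq_prod => i _; rewrite /b.
  by case: ifP => //= ; case: ifP => // /eqP i0; lia.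
(* Otherwise the first letter is split off, and the window moves to e - 1 in a word one letter
   shorter. *)
case: l le_l => [|l] le_l; first lia.
rewrite big_ord_recl /= [b 0]/b /= ifN; last lia.
rewrite mulnCA leq_mul2l; apply/orP; right.
rewrite subSn; last lia.
rewrite expnS leq_mul2l; apply/orP; right.
have le_l' : e.-1 + n <= l by lia.
rewrite -(prod_window q le_l'); apply: leq_prod => i _; rewrite /b /bump leq0n add1n.
by case: ifP => h; case: ifP => h'; lia.
Qed.

Section BoundedWords.
Variable L : nat.

Lemma card_overlap l s n d e :
  q * #|[set b : L.-bseq (letter X) | [&& size b == l, cyc_reduced b & overlap s n e (rot d b)]]|
  <= 2 * #|X| * q ^ (l - n).
Proof.
(* The letter at position i of the window copies the one [e] places earlier, or inverts the one at
   the mirror position e + n - 1 - i. *)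
pose g (t : word X) := nth a0 t (size t - e).
pose g' (t : word X) := linv (nth a0 t (e + n.-1 - size t)).
case: (boolP ((0 < e) && (e + n <= l))) => [/andP[e0 le_l]|nel]; last first.
  rewrite (_ : [set _ | _] = finset.set0) ?cards0 ?muln0 //; apply/finset.setP => b; rewrite !inE.
  apply/negP => /and3P[/eqP sb _ /and4P[e0 _]]; rewrite size_rot => le_l _.
  by case/negP: nel; rewrite e0 -sb.
have [lst lst_le lstP] := @words_determined e n l (if s then g else g') le_l (ltac:(lia)).
rewrite (negbTE (lt0n_neq0 e0)) in lst_le; apply: leq_trans lst_le.
rewrite leq_mul2l; apply/orP; right.
apply: (@card_le_size _ _ _ (fun b : L.-bseq (letter X) => rot d b)) => [b b' /rot_inj /val_inj //|b].
rewrite inE => /and3P[/eqP sb bc /and4P[_ ne le_b /eqP ov]].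
rewrite -(cyc_reduced_rot d) in bc.
move: (rot d b) bc ov le_b (size_rot d b); rewrite sb => w wc ov le_w wl.
apply: lstP => //; first by case/andP: wc.
move=> i /andP[ei ien].
have : nth a0 (take n (drop e w)) (i - e) = nth a0 w i.
  by rewrite nth_take ?nth_drop ?subnKC //; lia.
have sztn : size (take n w) = n by rewrite size_takel; lia.
have szti : size (take i w) = i by rewrite size_takel; lia.
rewrite ov => <-; case: s ne ov => /= ne ov; rewrite /g /g' szti.
  by rewrite !nth_take //; lia.
rewrite nth_rev size_map sztn; last lia.
rewrite (nth_map a0) ?sztn; last lia.
by rewrite !nth_take; [congr (linv (nth _ _ _))|..]; lia.
Qed.

(** The window starts at position 0, so no excess factor 2r/q arises. The map [h] stands for a
    rotation with or without inversion. *)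
Lemma card_prefix l n p (h : word X -> word X) :
  injective h -> (forall w, size (h w) = size w) ->
  (forall w, cyc_reduced (h w) = cyc_reduced w) -> 0 < n <= l ->
  #|[set b : L.-bseq (letter X) | [&& size b == l, cyc_reduced b & take n (h b) == p]]| <= q ^ (l - n).
Proof.
move=> hinj hsz hred /andP[n0 nl].
have [lst] := @words_determined 0 n l (fun t => nth a0 p (size t)) nl n0.
rewrite eqxx leq_pmul2l => [lst_le lstP|]; last first.
  by have := generators_gt0; lia.
apply: leq_trans lst_le.
apply: (@card_le_size _ _ _ (fun b : L.-bseq (letter X) => h b)) => [b b' /hinj /val_inj //|b].
rewrite inE -hred => /and3P[/eqP sb bc /eqP hp]; apply: lstP.
- by case/andP: bc.
- by rewrite hsz.
move=> i; rewrite add0n => /andP[_ in_]; rewrite -hp.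
by rewrite size_takel ?hsz ?sb ?nth_take //; lia.
Qed.

Lemma cyc_reduced1 x : cyc_reduced [:: x : letter X].
Proof. by rewrite cyc_reducedE /= /follows eq_sym linv_neq. Qed.

(** There are 2r choices for the first letter, q for each middle one and at least 2r - 2 for the
    last. Multiplying by q^2 avoids the exponent L - 2 and covers length 1. *)
Lemma card_cyc_reduced_ge :
  0 < L -> 2 * #|X| * (2 * #|X| - 2) * q ^ L <=
    q ^ 2 * #|[set b : L.-bseq (letter X) | cyc_reduced b && (size b == L)]|.
Proof.
have X0 := generators_gt0.
case: L => // l _.
(* The last letter, at position [l], must also not be inverse to the first one; a one-letter word is
   exempt. *)
pose P (s : word X) x := fits s x &&
  ((0 < l) && (size s == l) ==> follows x (head a0 s)).
have ext_ok n w : w \in extensions P n ->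
    reduced w /\ (0 < l -> n = l.+1 -> cyc_reduced w).
  elim: n w => [|n IHn] w; first by rewrite inE => /eqP->.
  case/extensionsP => t [x [-> tn /andP[fx cx]]]; have [tr _] := IHn _ tn.
  split=> [|l0 [nl]]; first exact: fits_reduced.
  move: cx; rewrite l0 (size_mem_extensions tn) nl eqxx /= => cx.
  have rx := fits_reduced tr fx.
  have tl := size_mem_extensions tn; case: t tn fx cx rx {tr} tl => [|a t] tn fx cx rx tl.
    by move: l0; rewrite -nl -tl.
  rewrite cyc_reducedE /= rcons_path last_rcons; apply/andP; split=> //.
apply: (@leq_trans (q ^ 2 * size (extensions P l.+1))); last first.
  rewrite leq_mul2l; apply/orP; right.
  set A := [set b : l.+1.-bseq (letter X) | _].
  rewrite [X in _ <= X]cardE -(size_map val); apply: uniq_leq_size.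
    exact: extensions_uniq.
  move=> w wl; have sw := size_mem_extensions wl.
  have swl : size w <= l.+1 by rewrite sw.
  apply/mapP; exists (Bseq swl) => //; rewrite mem_enum inE /= sw eqxx andbT.
  have [wr wc] := ext_ok _ _ wl.
  case: (posnP l) => [l0|l0]; last exact: wc.
  by case: w sw {swl wl wr wc} => [|x [|y w]]; rewrite l0 //= cyc_reduced1.
pose b i := if i == 0 then 2 * #|X| else if i == l then 2 * #|X| - 2 else q.
apply: (@leq_trans (q ^ 2 * \prod_(i < l.+1) b i)); last first.
  rewrite leq_mul2l; apply/orP; right; apply: size_extensions_ge => s.
  rewrite /b; case: eqP => s0.
    rewrite -card_letter; apply: subset_leq_card; apply/fintype.subsetP => x _.
    rewrite !inE /P (size0nil s0) /=; apply/implyP => /andP[l0 /eqP le0].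
    by rewrite -le0 in l0.
  case: s s0 => // a s _; case: eqP => sl; last first.
    have := card_fits (a :: s) => /= <-.
    apply: subset_leq_card; apply/fintype.subsetP => x fx; rewrite !inE /P.
    rewrite andbC; apply/andP; split=> //; apply/implyP => /andP[_ /eqP //].
  apply: (@leq_trans #|predC (pred2 (linv (last a s)) (linv a))|).
    rewrite -card_letter -(cardC (pred2 (linv (last a s)) (linv a))) card2.
    by case: (_ != _); rewrite /= leq_subLR // ltnW.
  apply: subset_leq_card; apply/fintype.subsetP => x; rewrite !inE negb_or.
  move=> /andP[xs xa]; apply/andP; split; first exact: xs.
  by apply/implyP => _; rewrite followsC; exact: xa.
rewrite /b; case: l {P ext_ok b} => [|l].
  by rewrite big_ord_recl big_ord0 /=; nia.
rewrite big_ord_recl big_ord_recr /= /bump leq0n add1n eqxx.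
rewrite (eq_bigr (fun=> q)) => [|i _].
  rewrite prod_nat_const card_ord -[l.+2]add2n expnD.
  by move: (2 * #|X| - 2) (q ^ 2) (q ^ l) => x y z; nia.
by rewrite /bump leq0n add1n /= ltn_eqF // ltnS.
Qed.
End BoundedWords.
End Counting.

(** * Varying one coordinate of a list *)

Section TupleCoordinate.
Variables (T : finType) (m : nat).
Implicit Types (W : m.-tuple T) (x : T).

Definition upd j W x : m.-tuple T := [tuple if t == j then x else tnth W t | t < m].

Lemma tnth_upd j W x t : tnth (upd j W x) t = if t == j then x else tnth W t.
Proof. by rewrite tnth_mktuple. Qed.

(* Double counting of the pairs (W, x) through the involution that swaps the
   j-th coordinate of W with x. *)
Lemma card_tuple_coord (A : {set T}) (P : pred (m.-tuple T)) j c n :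
  (forall W, c * #|[set x in A | P (upd j W x)]| <= n) ->
  c * (#|[set W : m.-tuple T | all [in A] W && P W]| * #|A|) <=
    #|[set W : m.-tuple T | all [in A] W]| * n.
Proof.
move=> Pn; set S := [set W : m.-tuple T | all [in A] W].
pose h (p : m.-tuple T * T) := (upd j p.1 p.2, tnth p.1 j).
have hK : involutive h.
  move=> [W x]; rewrite /h /= tnth_upd eqxx; congr pair.
  by apply: eq_from_tnth => t; rewrite !tnth_upd; case: eqP => // ->.
have hS p : p \in finset.setX S A -> h p \in finset.setX S A.
  case: p => W x; rewrite !inE /= => /andP[/all_tnthP WA xA]; rewrite WA andbT.
  have updA t : tnth (upd j W x) t \in A by rewrite tnth_upd; case: ifP.
  exact: (introT (@all_tnthP m T [in A] (upd j W x)) updA).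
rewrite -cardsX -(card_imset _ (inv_inj hK)).
apply: (@leq_trans (c * \sum_(W in S) #|[set x in A | P (upd j W x)]|)); last first.
  by rewrite big_distrr /= -sum_nat_const; apply: leq_sum => W _; apply: Pn.
rewrite leq_mul2l; apply/orP; right.
under eq_bigr do rewrite -sum1_card.
rewrite pair_big_dep /= sum1_card; apply: subset_leq_card.
apply/fintype.subsetP => _ /imsetP[[W x] + ->].
rewrite finset.in_setX => /andP[]; rewrite inE => /andP[WA PW] xA.
have WS : W \in S by rewrite inE.
have := hS (W, x); rewrite finset.in_setX WS xA => /(_ isT).
have := hK (W, x); rewrite finset.in_setX => -[hW _] /andP[hS1 hA].
apply/andP; split; first exact: hS1.
by rewrite inE; apply/andP; split; [exact: hA | rewrite hW].
Qed.

End TupleCoordinate.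

(** * Counting the lists that fail the criterion *)

Section FailureCount.
Variables (X : finType) (a0 : letter X) (k : nat -> nat) (l1 L m : nat).
Hypothesis k_gt0 : forall l, 0 < l -> 0 < k l.
Hypothesis k_le : forall l, 6 * k l <= l + 5.
Hypothesis k_mono : forall l l', l <= l' -> l - k l <= l' - k l'.
Hypothesis l1_le : l1 <= L.
Hypothesis L_gt0 : 0 < L.

Local Notation bword := (L.-bseq (letter X)).
Local Notation r := #|X|.
Local Notation q := (2 * r).-1.
Local Notation M := (q ^ (L - k L)).
Local Notation D := (L - l1).+1.

Definition relator_set : {set bword} := [set b : bword | cyc_reduced b && (l1 <= size b)].

Local Notation C := relator_set.

Lemma q_gt0 : 0 < q.
Proof. by have := generators_gt0 a0; lia. Qed.

Lemma k_small l : 0 < l -> k l <= l /\ (1 < l -> 2 * k l <= l).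
Proof. by move=> l0; have := k_le l; split; lia. Qed.

Lemma expq_mono l : l <= L -> q ^ (l - k l) <= M.
Proof. by move=> lL; apply: leq_pexp2l; [exact: q_gt0 | apply: k_mono]. Qed.

Lemma mem_relator_size (b : bword) : b \in C -> exists i : 'I_D, size b = l1 + i.
Proof.
rewrite inE => /andP[_ l1b]; have := size_bseq b => bL.
by exists (inord (size b - l1)); rewrite inordK; lia.
Qed.

(** Union bound over the length, the rotation, the offset and the sign of an overlap, at most 2r M /
    q words for each choice. *)
Lemma card_not_self_good :
  q * #|[set b in C | ~~ self_good k b]| <= q + D * (L * L * 2) * (2 * r * M).
Proof.
(* The empty word, never [self_good], accounts for the summand [q]. *)
rewrite (cardsD1 [bseq]) mulnDr; apply: leq_add.
  by case: (_ \in _); rewrite ?muln1 ?muln0.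
pose I : finType := ('I_D * ('I_L * 'I_L * bool))%type.
have cI : #|I| = D * (L * L * 2) by rewrite !card_prod !card_ord card_bool.
rewrite -cI.
pose F (i : I) := [set b : bword | [&& size b == l1 + i.1, cyc_reduced b &
  overlap i.2.2 (k (l1 + i.1)) i.2.1.2 (rot i.2.1.1 b)]].
apply: (card_cover_le (F := F)) => [b|i]; last first.
  apply: leq_trans (card_overlap a0 _ _ _ _ _ _) _; rewrite leq_mul2l; apply/orP; right.
  by apply: expq_mono; case: i => i _ /=; have := ltn_ord i; lia.
rewrite !inE => /andP[b0 /andP[bC bad]]; have [i bi] : exists i : 'I_D, size b = l1 + i.
  by apply: mem_relator_size; rewrite inE.
have bnil : (b : word X) != [::] by apply: contra b0 => /eqP bnil; apply/eqP/val_inj.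
have bpos : 0 < size b by rewrite lt0n size_eq0.
have [kb kb2] := k_small bpos; have bL := size_bseq b.
have kpos := k_gt0 bpos.
case/andP: bC => bc _.
move: bad; rewrite /self_good bnil /= => bad.
have [|d [e [s [db eb ov]]]] := not_uniq_overlap bc _ kb2 bad; first by rewrite kpos.
exists (i, (Ordinal (leq_trans db bL), Ordinal (leq_trans eb bL), s)).
by rewrite inE /= -bi eqxx bc.
Qed.

(** Union bound over the length of [b'] and over a rotation and a sign for each of the two words;
    each choice fixes the first letters of an element of the closure of [b']. *)
Lemma card_clash (b : bword) :
  #|[set b' in C | clash k b b']| <= D * (L * 2 * (L * 2)) * M.
Proof.
pose I : finType := ('I_D * ('I_L * bool * ('I_L * bool)))%type.
have cI : #|I| = D * (L * 2 * (L * 2)) by rewrite !card_prod !card_ord card_bool.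
rewrite -cI -[leqLHS]mul1n.
pose sym s (w : word X) := if s then w else finv w.
pose F (i : I) := [set b' : bword | [&& 0 < l1 + i.1, size b' == l1 + i.1, cyc_reduced b' &
  take (k (l1 + i.1)) (sym i.2.2.2 (rot i.2.2.1 b')) ==
  take (k (l1 + i.1)) (sym i.2.1.2 (rot i.2.1.1 b))]].
apply: (card_cover_le (F := F)) => [b'|i]; last first.
  rewrite mul1n; case: i => i [[d s] [d' s']]; rewrite /F /=.
  case: (posnP (l1 + i)) => [_|li].
    by rewrite (_ : [set _ | _] = finset.set0) ?cards0 //; apply/finset.setP => b'; rewrite !inE.
  apply: leq_trans (expq_mono (_ : l1 + i <= L)); last by have := ltn_ord i; lia.
  have [kl _] := k_small li; have kpos := k_gt0 li.
  apply: (@card_prefix X a0 L _ _ _ (fun w => sym s' (rot d' w))); last by rewrite kpos.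
  - move=> w w'; case: s' => /= [|/(inv_inj (@finvK X))]; exact: rot_inj.
  - by move=> w; case: s'; rewrite /sym ?size_finv size_rot.
  - by move=> w; case: s'; rewrite /sym ?cyc_reduced_finv cyc_reduced_rot.
rewrite inE => /andP[bC]; have [i bi] := mem_relator_size bC.
case/andP=> _ /hasP[_ /mapP[v /sym_seqP[d' [s' [db' vE]]] ->]].
case/mapP=> u /sym_seqP[d [s [db uE]]] uv.
have bL := size_bseq b; have bL' := size_bseq b'.
exists (i, (Ordinal (leq_trans db bL), s, (Ordinal (leq_trans db' bL'), s'))).
rewrite inE /= -bi eqxx (leq_ltn_trans _ db') //=.
move: bC; rewrite inE => /andP[-> _] /=; apply/eqP.
move: uv; rewrite uE vE; rewrite /sym; by case: s {uE}; case: s' {vE} => ->.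
Qed.

(** The words of maximal length alone are numerous enough. *)
Lemma card_relator_set_ge : 2 * r * (2 * r - 2) * q ^ L <= q ^ 2 * #|C|.
Proof.
apply: leq_trans (card_cyc_reduced_ge a0 L_gt0) _; rewrite leq_mul2l; apply/orP; right.
apply: subset_leq_card; apply/fintype.subsetP => b; rewrite !inE => /andP[-> /eqP->] //.
Qed.

Lemma card_relator_set_gt0 : 1 < r -> 0 < #|C|.
Proof.
move=> r1; have := card_relator_set_ge; case: (posnP #|C|) => // ->.
by rewrite muln0 leqn0 !muln_eq0 expn_eq0; have := q_gt0; lia.
Qed.

Local Notation S := [set W : m.-tuple bword | all [in C] W].

Definition all_goodb (W : m.-tuple bword) : bool :=
  all (fun b : bword => self_good k b) W &&
  [forall i, forall j, (i != j) ==> ~~ clash k (tnth W i) (tnth W j)].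

Lemma all_goodbP (W : m.-tuple bword) : all_goodb W -> all_good k (relators W).
Proof.
case/andP=> Wself /'forall_forallP Wpair; split; first by rewrite all_map.
move=> i j; rewrite /relators size_map size_tuple => im jm ij.
have := Wpair (Ordinal im) (Ordinal jm); rewrite -val_eqE /= ij /=.
rewrite !(tnth_nth [bseq]) /= => Wij.
by rewrite !(nth_map [bseq]) ?size_tuple.
Qed.

Lemma card_failure : 1 < r ->
  #|[set W in S | ~~ all_goodb W]| * q ^ L * q <=
  #|S| * (8 * m ^ 2 * r * L ^ 2 * D * M).
Proof.
move=> r1.
pose B1 := [set W in S | [exists i, ~~ self_good k (tnth W i)]].
pose B2 := [set W in S | [exists i, exists j, (i != j) && clash k (tnth W i) (tnth W j)]].
have B1le : q * #|C| * #|B1| <= m * (#|S| * (q + D * (L * L * 2) * (2 * r * M))).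
  rewrite -[X in X * (_ * _)]card_ord.
  apply: (card_cover_le (F := fun i : 'I_m => [set W : m.-tuple bword | all [in C] W && ~~ self_good k (tnth W i)])).
    by move=> W; rewrite !inE => /andP[WS /existsP[i Wi]]; exists i; rewrite inE WS.
  move=> i; rewrite -mulnA [#|C| * _]mulnC; apply: (card_tuple_coord (j := i)) => W.
  apply: leq_trans card_not_self_good; rewrite leq_mul2l; apply/orP; right.
  apply: subset_leq_card; apply/fintype.subsetP => b.
  by rewrite !inE tnth_upd eqxx.
(* Ordered pairs of distinct indices are encoded by [lift]; the coordinate that varies is that of
   the shorter relator, the others being fixed. *)
have B2le : #|C| * #|B2| <= m * m.-1 * (#|S| * (D * (L * 2 * (L * 2)) * M)).
  have -> : m * m.-1 = #|{: 'I_m * 'I_m.-1}| by rewrite card_prod !card_ord.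
  apply: (card_cover_le (F := fun p : 'I_m * 'I_m.-1 =>
    [set W : m.-tuple bword | all [in C] W && clash k (tnth W (lift p.1 p.2)) (tnth W p.1)])).
    move=> W; rewrite !inE => /andP[WS /existsP[i /existsP[j /andP[ij Wij]]]].
    have [t jt|ij'] := unliftP j i; last by rewrite ij' eqxx in ij.
    by exists (j, t); rewrite inE WS /= -jt.
  case=> i t /=; rewrite [#|C| * _]mulnC -[leqLHS]mul1n; apply: (card_tuple_coord (j := i)) => W.
  rewrite mul1n; apply: leq_trans (card_clash (tnth W (lift i t))).
  apply: subset_leq_card; apply/fintype.subsetP => b.
  by rewrite !inE !tnth_upd eqxx eq_sym (negbTE (neq_lift _ _)).
have Ble : #|[set W in S | ~~ all_goodb W]| <= #|B1| + #|B2|.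
  apply: leq_trans (leq_card_setU _ _); apply: subset_leq_card.
  apply/fintype.subsetP => W; rewrite !inE => /andP[-> /=].
  rewrite negb_and -has_predC => /orP[/hasP[b /tnthP[i ->] bi]|].
    by apply/orP; left; apply/existsP; exists i.
  rewrite negb_forall => /existsP[i]; rewrite negb_forall => /existsP[j].
  rewrite negb_imply negbK => ij; apply/orP; right.
  by apply/existsP; exists i; apply/existsP; exists j.
have Nge := card_relator_set_ge; have q0 := q_gt0; have N0 := card_relator_set_gt0 r1.
have M0 : 0 < M by rewrite expn_gt0 q0.
move: #|C| #|B1| #|B2| #|[set W in S | _]| #|S| Nge N0 B1le B2le Ble => N b1 b2 f s.
move=> Nge N0 B1le B2le Ble.
pose E := D * (L * L) * M.
have E0 : 0 < E by rewrite !muln_gt0 L_gt0 M0.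
have Nfle : N * f <= 4 * m ^ 2 * s * E.
  rewrite -(leq_pmul2l q0).
  (* Since r is at least 2 and E at least 1, q + 4rE is at most 4qE, which absorbs the empty
     word. *)
  have b1le : q * (N * b1) <= m * s * (4 * q * E).
    rewrite mulnA; apply: leq_trans B1le _; rewrite mulnA leq_mul2l; apply/orP; right.
    rewrite (_ : D * (L * L * 2) * (2 * r * M) = 4 * r * E); last by rewrite /E; lia.
    by nia.
  have b2le : q * (N * b2) <= m * m.-1 * s * (4 * q * E).
    apply: (@leq_trans (q * (m * m.-1 * (s * (D * (L * 2 * (L * 2)) * M))))).
      by rewrite leq_mul2l B2le orbT.
    by rewrite /E; lia.
  (* The two index counts add up to m + m(m - 1) = m^2. *)
  apply: (@leq_trans (q * (N * b1) + q * (N * b2))).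
    by rewrite -!mulnDr !leq_mul2l Ble !orbT.
  apply: leq_trans (leq_add b1le b2le) _.
  by case: (m) => [|m'] //=; lia.
(* This reduces to q^3 <= (2r)^2 (2r - 2); with t = r - 1 it reads 8t^3 + 12t^2 + 6t + 1 <= 8t^3 +
   16t^2 + 8t. *)
have Nq : q * q ^ L <= N * (2 * r).
  rewrite -(@leq_pmul2l (q ^ 2)) ?expn_gt0 ?q0 // [leqRHS]mulnA.
  apply: (@leq_trans (2 * r * (2 * r - 2) * q ^ L * (2 * r))); last first.
    by rewrite leq_mul2r Nge orbT.
  rewrite mulnA -expnSr mulnAC leq_mul2r; apply/orP; right.
  rewrite !expnS expn0 muln1.
  have [t rt t0] : exists2 t, r = t.+1 & 0 < t by exists r.-1; lia.
  have -> : q = 2 * t + 1 by lia.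
  have -> : 2 * r - 2 = 2 * t by lia.
  rewrite rt; nia.
apply: (@leq_trans (f * (N * (2 * r)))).
  by rewrite -mulnA leq_mul2l [q ^ L * _]mulnC Nq orbT.
apply: (@leq_trans (4 * m ^ 2 * s * E * (2 * r))).
  by rewrite mulnA leq_mul2r [f * N]mulnC Nfle orbT.
by rewrite /E -[L ^ 2]mulnn; lia.
Qed.
End FailureCount.

(** * The critical prefix length *)

Local Open Scope classical_set_scope.
Local Open Scope ring_scope.

(** The least prefix length that violates the small cancellation inequality for a word of length
    [l]. *)
Definition piece_len (R : realType) (lambda : R) (l : nat) : nat :=
  `|Num.ceil (lambda * l%:R)|%N.

Section PieceLength.
Variables (R : realType) (lambda : R).
Hypotheses (lambda_gt0 : 0 < lambda) (lambda_le : lambda <= 6%:R^-1).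
Local Notation k := (piece_len lambda).

Lemma piece_len_ge l : lambda * l%:R <= (k l)%:R.
Proof.
have h0 : 0 <= lambda * l%:R by rewrite mulr_ge0 // ltW.
rewrite /piece_len natr_absz ger0_norm ?ceil_ge //.
by rewrite ceil_ge0 (lt_le_trans _ h0).
Qed.

Lemma piece_len_le l n : lambda * l%:R <= n%:R -> (k l <= n)%N.
Proof.
have h0 : 0 <= lambda * l%:R by rewrite mulr_ge0 // ltW.
move=> le_n; rewrite -(ler_nat int) /piece_len natz gez0_abs; last first.
  by rewrite ceil_ge0 (lt_le_trans _ h0).
by rewrite natz ceil_le_int -pmulrn.
Qed.

Lemma piece_len_gt0 l : (0 < l)%N -> (0 < k l)%N.
Proof.
move=> l0; rewrite -(ltr_nat R); apply: lt_le_trans (piece_len_ge l).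
by rewrite mulr_gt0 ?ltr0n.
Qed.

(** As lambda is at most 1/6, the ceiling is at most that of l/6, which is [(l + 5) %/ 6]. *)
Lemma piece_len_small l : (6 * k l <= l + 5)%N.
Proof.
suff : (k l <= (l + 5) %/ 6)%N by lia.
apply: piece_len_le; apply: (@le_trans _ _ (6%:R^-1 * l%:R)).
  by rewrite ler_wpM2r.
rewrite ler_pdivrMl // -natrM ler_nat; lia.
Qed.

(** As lambda is at most 1, the ceiling grows no faster than the length. *)
Lemma piece_len_mono l l' : (l <= l')%N -> (l - k l <= l' - k l')%N.
Proof.
move=> ll'; suff : (k l' <= k l + (l' - l))%N by lia.
apply: piece_len_le; rewrite natrD -{1}(subnKC ll') natrD mulrDr lerD //.
  exact: piece_len_ge.
rewrite ler_piMl //; apply: (le_trans lambda_le); lra.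
Qed.

End PieceLength.

(** * The explicit bound: closed form, probability and limit *)

Definition failure_bound (R : realType) (lambda : R) (r l1 l2 m : nat) : R :=
  8 * m%:R ^+ 2 * r%:R * l2%:R ^+ 2 * (l2%:R - l1%:R + 1) *
  (2 * r%:R - 1) `^ (- lambda * l2%:R - 1).

Lemma failure_bound_closed_form (R : realType) :
  closed_form (fun (lambda : R) r l1 l2 m => 1 - failure_bound lambda r l1 l2 m).
Proof.
exists (CFsub (CFnat 1) (CFmul (CFmul (CFmul (CFmul (CFmul (CFnat 8)
  (CFpow CFm (CFnat 2))) CFr) (CFpow CFl2 (CFnat 2)))
  (CFadd (CFsub CFl2 CFl1) (CFnat 1)))
  (CFpow (CFsub (CFmul (CFnat 2) CFr) (CFnat 1))
     (CFsub (CFmul (CFsub (CFnat 0) CFlambda) CFl2) (CFnat 1))))).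
move=> lambda r l1 l2 m [_ _ r2 _ _].
(* Negation is written as subtraction from 0 and the squares as integer powers, to match the
   constructors. *)
rewrite /failure_bound -[- lambda]sub0r !exprnP.
do !constructor => //.
- by rewrite orbT.
- by rewrite orbT.
by rewrite subr_gt0 -natrM ltr1n; lia.
Qed.

Lemma success_probability (R : realType) (lambda : R) (r l1 l2 m : nat)
    (X : finType) :
  admissible lambda r l1 l2 m -> #|X| = r ->
  1 - failure_bound lambda r l1 l2 m <=
    unif_prob R (presentations X l1 l2 m)
      (fun W => all (@power_free X) (relators W) /\
                small_cancellation lambda (relators W)).
Proof.
move=> [lam0 lam6 r2 m1 [l12 l20]] Xr.
have /card_gt0P[x0 _] : (0 < #|X|)%N by rewrite Xr; lia.
pose a0 : letter X := (x0, true); pose k := piece_len lambda.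
have k0 := @piece_len_gt0 _ _ lam0; have k6 := piece_len_small lam0 lam6.
have kmono := piece_len_mono lam0 lam6.
have fail := @card_failure X a0 k l1 l2 m k0 k6 kmono l12 l20.
rewrite Xr in fail; have {}fail := fail r2.
have N0 := card_relator_set_gt0 a0 l12 l20 (ltac:(lia) : (1 < #|X|)%N).
rewrite /unif_prob (_ : presentations X l1 l2 m =
    [set W : m.-tuple (l2.-bseq (letter X)) | all [in relator_set X l1 l2] W]%SET); last first.
  by apply/finset.setP => W; rewrite !inE; apply: eq_all => b; rewrite inE.
set P := [set W : m.-tuple (l2.-bseq (letter X)) | all [in relator_set X l1 l2] W]%SET in fail *.
set bad := #|[set W in P | ~~ all_goodb k W]%SET| in fail.
set good := #|_|.
have P0 : (0 < #|P|)%N.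
  have /card_gt0P[b bC] := N0; apply/card_gt0P; exists [tuple of nseq m b].
  by rewrite inE all_nseq bC orbT.
have Pgb : (#|P| <= good + bad)%N.
  apply: leq_trans (leq_card_setU _ _); apply: subset_leq_card.
  apply/fintype.subsetP => W WP; rewrite !inE in WP *; rewrite WP /=.
  case: (boolP (all_goodb k W)) => [/all_goodbP Wg|_]; last by rewrite orbT.
  rewrite orbF; apply/asboolP; split.
    by apply/allP => w wW; have [/allP/(_ w wW)/self_good_power_free] := Wg.
  by apply: all_good_small_cancellation Wg => l n _; apply: piece_len_le.
have q1 : 1 <= ((2 * r).-1)%N%:R :> R by rewrite ler1n; lia.
have kl : (k l2 <= l2)%N by move: (k6 l2); rewrite -/k; lia.
set Q := ((2 * r).-1)%N%:R in q1.
have QE : 2 * r%:R - 1 = Q :> R.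
  by rewrite /Q -natrM -subn1 natrB //; lia.
have Q0 : 0 < Q by apply: lt_le_trans q1.
(* The exponent on the right sums to (1 - lambda) l2, which is at least l2 - k(l2) because k(l2) is
   at least lambda l2. *)
have powQ : Q ^+ (l2 - k l2) <= Q ^+ l2 * Q * Q `^ (- lambda * l2%:R - 1).
  rewrite -exprSr -!powR_mulrn ?(ltW Q0) // -powRD; last by apply/implyP => _; rewrite gt_eqF.
  apply: ler_powR => //; rewrite natrB // -natr1.
  have := piece_len_ge lam0 l2; rewrite -/k; lra.
have bad_le : bad%:R <= #|P|%:R * failure_bound lambda r l1 l2 m.
  rewrite -(@ler_pM2r _ (Q ^+ l2 * Q)); last by rewrite mulr_gt0 // exprn_gt0.
  have : (bad * (2 * r).-1 ^ l2 * (2 * r).-1)%N%:R <=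
    (#|P| * (8 * m ^ 2 * r * l2 ^ 2 * (l2 - l1).+1 * (2 * r).-1 ^ (l2 - k l2)))%N%:R :> R.
    by rewrite ler_nat.
  rewrite !natrM !natrX -/Q -[(l2 - l1).+1%:R]natr1 natrB // => le_f.
  rewrite mulrA; apply: (le_trans le_f).
  rewrite /failure_bound QE -!expr2 -[leRHS]mulrA ler_wpM2l // -[leRHS]mulrA.
  apply: ler_wpM2l; last by rewrite mulrC.
  by rewrite mulr_ge0 // -natrB // natr1.
rewrite ler_pdivlMr ?ltr0n // mulrBl mul1r lerBlDr.
apply: (@le_trans _ _ (good + bad)%:R); first by rewrite ler_nat.
by rewrite natrD lerD2l mulrC.
Qed.

(** Squeeze below a multiple of 1/(n + 1): the polynomial factors are at most cubic in n + 1, and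
    the exponential beats its fourth power. *)
Lemma failure_bound_cvg (R : realType) (lambda : R) (r m : nat) (l1 : nat -> nat) :
  0 < lambda -> (2 <= r)%N -> (\forall n \near \oo, (l1 n <= n)%N) ->
  (fun n => failure_bound lambda r (l1 n) n m) @ \oo --> (0 : R).
Proof.
move=> lam0 r2 l1n.
have Q1 : 1 < 2 * r%:R - 1 :> R.
  have : 2 <= r%:R :> R by rewrite ler_nat.
  lra.
have lnQ : 0 < ln (2 * r%:R - 1 : R) by rewrite ln_gt0.
(* With this [c], (2r - 1)^(lambda n) is the fourth power of exp(c n), and exp(c n) >= 1 + c n >= d
   (n + 1) for d = min(1, c). *)
pose c := lambda * ln (2 * r%:R - 1) / 4.
have c0 : 0 < c by rewrite divr_gt0 ?mulr_gt0.
pose d := Num.min 1 c.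
have d0 : 0 < d by rewrite lt_min ltr01.
apply: (@squeeze_cvgr _ _ _ _ (cst 0) (fun n => 8 * m%:R ^+ 2 * r%:R * d ^- 4 * harmonic n)).
- near=> n.
  have l1l : (l1 n <= n)%N by near: n.
  have n0 : 0 < n.+1%:R :> R by rewrite ltr0n.
  rewrite /failure_bound; set A := 8 * m%:R ^+ 2 * r%:R.
  have A0 : 0 <= A by rewrite !mulr_ge0.
  have lD0 : 0 <= n%:R - (l1 n)%:R + 1 :> R by rewrite -natrB // natr1.
  have lD : n%:R - (l1 n)%:R + 1 <= n.+1%:R :> R by rewrite -natr1 lerD2r gerBl.
  have powQ : (2 * r%:R - 1) `^ (- lambda * n%:R - 1) <= (d * n.+1%:R) ^- 4.
    have cn : d * n.+1%:R <= expR (c * n%:R).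
      apply: (@le_trans _ _ (1 + c * n%:R)); last exact: expR_ge1Dx.
      rewrite -natr1 mulrDr mulr1 addrC lerD ?ge_min ?lexx //.
      by rewrite ler_wpM2r // ge_min lexx orbT.
    apply: (@le_trans _ _ ((2 * r%:R - 1) `^ (- (lambda * n%:R)))).
      by apply: ler_powR; [exact: ltW | rewrite mulNr gerBl].
    rewrite powRN lef_pV2 ?posrE ?powR_gt0 ?exprn_gt0 ?mulr_gt0 //; try lra.
    rewrite /powR gt_eqF; last lra.
    have -> : lambda * n%:R * ln (2 * r%:R - 1) = 4%:R * (c * n%:R).
      by rewrite /c; field.
    by rewrite expRM_natl lerXn2r ?nnegrE ?expR_ge0 // ltW ?mulr_gt0.
  rewrite /cst /= mulr_ge0 ?powR_ge0 ?mulr_ge0 ?exprn_ge0 //=.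
  apply: (@le_trans _ _ (A * n.+1%:R ^+ 2 * n.+1%:R * (d * n.+1%:R) ^- 4)).
    rewrite ler_pM ?powR_ge0 ?mulr_ge0 ?exprn_ge0 //.
    rewrite ler_pM ?mulr_ge0 ?exprn_ge0 // ler_wpM2l // lerXn2r ?nnegrE ?ler_nat //.
  rewrite le_eqVlt; apply/orP; left; apply/eqP; rewrite /harmonic /=.
  by field; rewrite !gt_eqF.
- exact: cvg_cst.
rewrite -[X in _ --> X](mulr0 (8 * m%:R ^+ 2 * r%:R * d ^- 4)).
apply: cvgMr; exact: cvg_harmonic.
Unshelve. all: by end_near.
Qed.

Theorem theorem1p1 (R : realType) :
  exists p : R -> nat -> nat -> nat -> nat -> R,
    [/\ closed_form p,
        forall (lambda : R) (r l1 l2 m : nat) (X : finType),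
          admissible lambda r l1 l2 m -> #|X| = r ->
          p lambda r l1 l2 m <=
            unif_prob R (presentations X l1 l2 m)
              (fun W => all (@power_free X) (relators W) /\
                        small_cancellation lambda (relators W)),
        forall (lambda : R) (r l1 l2 m : nat),
          admissible lambda r l1 l2 m ->
          1 - p lambda r l1 l2 m <=
            8 * m%:R ^+ 2 * r%:R * l2%:R ^+ 2 * (l2%:R - l1%:R + 1) *
            (2 * r%:R - 1) `^ (- lambda * l2%:R - 1) &
        forall (lambda : R) (r m : nat) (l1 : nat -> nat),
          0 < lambda -> lambda <= 6%:R^-1 -> (2 <= r)%N -> (1 <= m)%N ->
          (\forall n \near \oo, (l1 n <= n)%N) ->
          (fun l2 : nat => p lambda r (l1 l2) l2 m) @ \oo --> (1 : R)].

Proof.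
exists (fun lambda r l1 l2 m => 1 - failure_bound lambda r l1 l2 m); split.
- exact: failure_bound_closed_form.
- exact: success_probability.
- by move=> lambda r l1 l2 m _; rewrite subKr.
move=> lambda r m l1 lam0 _ r2 _ l1n; rewrite -[X in _ --> X]subr0.
by apply: cvgB; [exact: cvg_cst | exact: failure_bound_cvg].
Qed.
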